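(* Assume that the limits below exist. Then, in the limit $N\to\infty$, the quenched pressure of the diluted two-body (Curie–Weiss) model admits the representation $$A(\alpha,\beta)=\ln 2-\alpha\,\frac{\partial A(\alpha,\beta)}{\partial\alpha}+\Psi(\alpha,\beta;t=1).$$
   Context: Fix $N\in\mathbb N$, a connectivity $\alpha>1/2$ and an inverse temperature $\beta>0$. Spins are $\sigma=(\sigma_1,\dots,\sigma_N)\in\{-1,1\}^N$. Let $P_{\alpha N}$ be a Poisson random variable with mean $\alpha N$, and let $\{i_\nu\},\{j_\nu\}$ be independent families of i.i.d. random variables uniformly distributed on $\{1,\dots,N\}$, independent of $P_{\alpha N}$. The Hamiltonian is $H_N(\sigma,\alpha)=-\sum_{\nu=1}^{P_{\alpha N}}\sigma_{i_\nu}\sigma_{j_\nu}$, the partition function is $Z_N(\alpha,\beta)=\sum_\sigma e^{-\beta H_N(\sigma,\alpha)}$, $\mathbb E$ denotes expectation over all the quenched random variables, $A_N(\alpha,\beta)=\frac1N\mathbb E\ln Z_N(\alpha,\beta)$ and $A(\alpha,\beta)=\lim_{N\to\infty}A_N(\alpha,\beta)$. Set $\tilde\alpha=\frac{N}{N+1}\alpha$. For $t\in[0,1]$ let $P'_{2\tilde\alpha t}$ be a Poisson variable with mean $2\tilde\alpha t$ and $\{k_\nu\}$ i.i.d. uniform on $\{1,\dots,N\}$, all independent of everything else, and define $$Z_{N,t}(\tilde\alpha,\beta)=\sum_\sigma \exp\Big(\beta\sum_{\nu=1}^{P_{\tilde\alpha N}}\sigma_{i_\nu}\sigma_{j_\nu}+\beta\sum_{\nu=1}^{P'_{2\tilde\alpha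 t}}\sigma_{k_\nu}\Big),$$ the cavity function $\Psi_N(\tilde\alpha,\beta;t)=\mathbb E\ln\big(Z_{N,t}(\tilde\alpha,\beta)/Z_N(\tilde\alpha,\beta)\big)$ and $\Psi(\alpha,\beta;t)=\lim_{N\to\infty}\Psi_N(\tilde\alpha,\beta;t)$. *)

(* Defs.v *)
From Stdlib Require Import Reals Lra List Arith ClassicalEpsilon.
Import ListNotations.
Open Scope R_scope.

Definition rsum {A : Type} (f : A -> R) (l : list A) : R :=
  fold_right (fun x acc => f x + acc) 0 l.

Fixpoint tuples (N k : nat) : list (list nat) :=
  match k with
  | O => [[]]
  | S k' => flat_map (fun i => map (cons i) (tuples N k')) (seq 0 N)
  end.

Fixpoint spins (N : nat) : list (list R) :=
  match N with
  | O => [[]]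
  | S n => flat_map (fun s => [1 :: s; -1 :: s]) (spins n)
  end.

(* Expectation over k i.i.d. indices uniform on {0,...,N-1}. *)
Definition avg_idx (N k : nat) (f : list nat -> R) : R :=
  rsum f (tuples N k) / (INR N ^ k).

Definition poisson (lam : R) (k : nat) : R :=
  exp (- lam) * lam ^ k / INR (fact k).

Definition series (u : nat -> R) : R :=
  epsilon (inhabits 0) (fun l => Un_cv (fun n => sum_f_R0 u n) l).

Definition bond_energy (s : list R) (is js : list nat) : R :=
  rsum (fun p => nth (fst p) s 0 * nth (snd p) s 0) (combine is js).

Definition field_energy (s : list R) (ks : list nat) : R :=
  rsum (fun k => nth k s 0) ks.

(* Z_N for a fixed realization of the bonds. *)
Definition Zb (N : nat) (beta : R) (is js : list nat) : R :=
  rsum (fun s => exp (beta * bond_energy s is js)) (spins N).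

(* Z_{N,t} for a fixed realization of bonds and cavity fields. *)
Definition Zt (N : nat) (beta : R) (is js ks : list nat) : R :=
  rsum (fun s => exp (beta * bond_energy s is js + beta * field_energy s ks))
       (spins N).

(* A_N(alpha,beta) = (1/N) E ln Z_N(alpha,beta) *)
Definition A_N (N : nat) (alpha beta : R) : R :=
  / INR N *
  series (fun k => poisson (alpha * INR N) k *
            avg_idx N k (fun is => avg_idx N k (fun js => ln (Zb N beta is js)))).

(* Psi_N(alpha,beta;t) = E ln (Z_{N,t}(alpha,beta) / Z_N(alpha,beta)) *)
Definition Psi_N (N : nat) (alpha beta t : R) : R :=
  series (fun k => poisson (alpha * INR N) k *
    series (fun m => poisson (2 * alpha * t) m *
      avg_idx N k (fun is => avg_idx N k (fun js => avg_idx N m (fun ks =>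
        ln (Zt N beta is js ks / Zb N beta is js)))))).

Definition alpha_tilde (N : nat) (alpha : R) : R := INR N / INR (N + 1) * alpha.

(* Main.v *)
Require Import Defs.
From Stdlib Require Import Reals.
From Stdlib Require Import Lra Lia Arith List Permutation ClassicalEpsilon.
From Coquelicot Require Import Coquelicot.
Import ListNotations.
Open Scope R_scope.

(* Add one spin: after the gauge transformation sigma_i -> sigma_i sigma_0, a
   bond of the (N+1)-spin system becomes a bond, a cavity field or a constant, and
   Poisson thinning splits the three kinds into independent Poisson families.
   With F_N(a) = N A_N(a), this gives
     F_{N+1}(alpha) = ln 2 + beta alpha / (N+1) + F_N(alpha~) + Psi_N(alpha~; 1).
   By the second Griffiths inequality ln Z_N is supermodular in the bonds, so A_N
   is convex in alpha; as alpha - alpha~ = alpha / (N+1), convexity turns the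
   differentiability of the limit A into F_N(alpha) - F_N(alpha~) -> alpha A'(alpha).
   Hence F_{N+1}(alpha) - F_N(alpha) converges to ln 2 - alpha A'(alpha) + Psi, and
   by Cesaro so does F_N(alpha) / N. *)

(** The value of alpha~ is forced by bookkeeping of rates. In the system of N+1 spins each ordered
    pair of sites is a Poisson stream of rate c = alpha/(N+1). The N^2 pairs avoiding the new spin
    keep this rate and have total mean c N^2 = alpha~ N; the 2N pairs meeting it once become fields
    of total mean 2 c N = 2 alpha~, which is t = 1; the pair of the new spin with itself has mean c
    and yields the constant beta c. The analytic obstacle is that alpha~ moves with N while A_N is
    only known to converge pointwise near alpha, so a difference quotient with vanishing step cannot
    be passed to the limit directly. Convexity supplies the missing uniformity, and it is reached
    because differentiating a Poisson expectation in its mean gives the expectation of a forward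
    difference. *)

Section FiniteSums.
Context {A B : Type}.
Implicit Types (f g : A -> R) (L : list A).

Lemma rsum_ext_in f g L :
  (forall x, In x L -> f x = g x) -> rsum f L = rsum g L.
Proof.
induction L as [|x L IH]; intros H; simpl; [reflexivity|].
rewrite (H x), IH; [reflexivity| |now left].
intros y Hy; apply H; now right.
Qed.

Lemma rsum_ext f g L : (forall x, f x = g x) -> rsum f L = rsum g L.
Proof. intros H; apply rsum_ext_in; auto. Qed.

Lemma rsum_app f L1 L2 : rsum f (L1 ++ L2) = rsum f L1 + rsum f L2.
Proof. induction L1 as [|x L IH]; simpl; [|rewrite IH]; ring. Qed.

Lemma rsum_map (h : B -> R) (t : A -> B) L :
  rsum h (map t L) = rsum (fun x => h (t x)) L.
Proof. induction L as [|x L IH]; simpl; [|rewrite IH]; ring. Qed.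

Lemma rsum_plus f g L : rsum (fun x => f x + g x) L = rsum f L + rsum g L.
Proof. induction L as [|x L IH]; simpl; [|rewrite IH]; ring. Qed.

Lemma rsum_scal c f L : rsum (fun x => c * f x) L = c * rsum f L.
Proof. induction L as [|x L IH]; simpl; [|rewrite IH]; ring. Qed.

Lemma rsum_minus f g L : rsum (fun x => f x - g x) L = rsum f L - rsum g L.
Proof. induction L as [|x L IH]; simpl; [|rewrite IH]; ring. Qed.

Lemma rsum_const c L : rsum (fun _ => c) L = INR (length L) * c.
Proof.
induction L as [|x L IH]; [simpl; ring|].
cbn [length]; rewrite S_INR; simpl; rewrite IH; ring.
Qed.

Lemma rsum_le f g L :
  (forall x, In x L -> f x <= g x) -> rsum f L <= rsum g L.
Proof.
induction L as [|x L IH]; intros H; simpl; [lra|].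
apply Rplus_le_compat; [apply H; now left|].
apply IH; intros y Hy; apply H; now right.
Qed.

Lemma rsum_ge0 f L : (forall x, In x L -> 0 <= f x) -> 0 <= rsum f L.
Proof.
intros H; apply Rle_trans with (rsum (fun _ => 0) L).
- rewrite rsum_const; lra.
- now apply rsum_le.
Qed.

Lemma rsum_abs f L : Rabs (rsum f L) <= rsum (fun x => Rabs (f x)) L.
Proof.
induction L as [|x L IH]; simpl; [rewrite Rabs_R0; lra|].
eapply Rle_trans; [apply Rabs_triang|lra].
Qed.

End FiniteSums.

Lemma rsum_flat_map {A B : Type} (h : B -> R) (t : A -> list B) (L : list A) :
  rsum h (flat_map t L) = rsum (fun x => rsum h (t x)) L.
Proof.
induction L as [|x L IH]; simpl; [reflexivity|].
now rewrite rsum_app, IH.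
Qed.

Lemma rsum_swap {A B : Type} (f : A -> B -> R) L M :
  rsum (fun x => rsum (f x) M) L = rsum (fun y => rsum (fun x => f x y) L) M.
Proof.
induction L as [|x L IH]; simpl.
- rewrite rsum_const; ring.
- now rewrite IH, <- rsum_plus.
Qed.

Lemma rsum_sum_f_R0 {A : Type} (h : A -> nat -> R) L n :
  rsum (fun x => sum_f_R0 (h x) n) L = sum_f_R0 (fun j => rsum (fun x => h x j) L) n.
Proof.
induction n as [|n IH]; [reflexivity|].
now rewrite tech5, <- IH, <- rsum_plus.
Qed.

Lemma rsum_list_prod {A B : Type} (h : A * B -> R) L M :
  rsum h (list_prod L M) = rsum (fun x => rsum (fun y => h (x, y)) M) L.
Proof.
induction L as [|x L IH]; simpl; [reflexivity|].
now rewrite rsum_app, rsum_map, IH.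
Qed.

Lemma rsum_mult {A B : Type} (f : A -> R) (g : B -> R) L M :
  rsum f L * rsum g M = rsum (fun x => rsum (fun y => f x * g y) M) L.
Proof.
rewrite Rmult_comm, <- rsum_scal; apply rsum_ext; intros x.
now rewrite rsum_scal, Rmult_comm.
Qed.

(** * Sums over words of fixed length: unnormalised averages over i.i.d. letters *)

Fixpoint wsum {A : Type} (L : list A) (k : nat) (f : list A -> R) : R :=
  match k with
  | O => f []
  | S k' => rsum (fun x => wsum L k' (fun w => f (x :: w))) L
  end.

Section Words.
Context {A : Type}.
Implicit Types (f g : list A -> R) (L : list A).

Lemma wsum_ext_len L k f g :
  (forall w, length w = k -> f w = g w) -> wsum L k f = wsum L k g.
Proof.
revert f g; induction k as [|k IH]; intros f g H; simpl.
- now apply H.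
- apply rsum_ext; intros x; apply IH; intros w Hw; apply H; simpl; lia.
Qed.

Lemma wsum_ext L k f g : (forall w, f w = g w) -> wsum L k f = wsum L k g.
Proof. intros H; apply wsum_ext_len; auto. Qed.

Lemma wsum_plus L k f g :
  wsum L k (fun w => f w + g w) = wsum L k f + wsum L k g.
Proof.
revert f g; induction k as [|k IH]; intros f g; simpl; [reflexivity|].
rewrite <- rsum_plus; apply rsum_ext; intros x.
now rewrite (IH (fun w => f (x :: w)) (fun w => g (x :: w))).
Qed.

Lemma wsum_scal L k c f : wsum L k (fun w => c * f w) = c * wsum L k f.
Proof.
revert f; induction k as [|k IH]; intros f; simpl; [reflexivity|].
rewrite <- rsum_scal; apply rsum_ext; intros x.
now rewrite (IH (fun w => f (x :: w))).
Qed.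

Lemma wsum_minus L k f g :
  wsum L k (fun w => f w - g w) = wsum L k f - wsum L k g.
Proof.
unfold Rminus; replace (- wsum L k g) with (-1 * wsum L k g) by ring.
rewrite <- wsum_scal, <- wsum_plus; apply wsum_ext; intros w; ring.
Qed.

Lemma wsum_const L k c : wsum L k (fun _ => c) = INR (length L) ^ k * c.
Proof.
induction k as [|k IH]; simpl; [ring|].
rewrite IH, rsum_const; ring.
Qed.

Lemma wsum_rsum {B : Type} (M : list B) L k (f : B -> list A -> R) :
  wsum L k (fun w => rsum (fun y => f y w) M) = rsum (fun y => wsum L k (f y)) M.
Proof.
revert f; induction k as [|k IH]; intros f; simpl; [reflexivity|].
rewrite <- rsum_swap; apply rsum_ext; intros x.
now rewrite <- (IH (fun y w => f y (x :: w))).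
Qed.

Lemma wsum_ge0 L k f : (forall w, 0 <= f w) -> 0 <= wsum L k f.
Proof.
revert f; induction k as [|k IH]; intros f H; simpl; [apply H|].
apply rsum_ge0; intros x _; apply IH; intros w; apply H.
Qed.

Lemma wsum_abs_le L k f M :
  (forall w, length w = k -> Rabs (f w) <= M) ->
  Rabs (wsum L k f) <= INR (length L) ^ k * M.
Proof.
revert f; induction k as [|k IH]; intros f H; simpl.
- rewrite Rmult_1_l; now apply H.
- eapply Rle_trans; [apply rsum_abs|].
  rewrite Rmult_assoc, <- (rsum_const _ L).
  apply rsum_le; intros x _; apply IH; intros w Hw; apply H; simpl; lia.
Qed.

Lemma wsum_functional L M k f :
  (forall h, rsum h L = rsum h M) -> wsum L k f = wsum M k f.
Proof.
intros H; revert f; induction k as [|k IH]; intros f; simpl; [reflexivity|].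
rewrite H; apply rsum_ext; intros x; apply IH.
Qed.

Lemma wsum_double L k f : wsum (L ++ L) k f = 2 ^ k * wsum L k f.
Proof.
revert f; induction k as [|k IH]; intros f; simpl; [ring|].
rewrite rsum_app.
rewrite (rsum_ext _ _ L (fun x => IH (fun w => f (x :: w)))), rsum_scal; ring.
Qed.

Lemma wsum_singleton a k f : wsum [a] k f = f (repeat a k).
Proof.
revert f; induction k as [|k IH]; intros f; simpl; [reflexivity|].
rewrite IH; simpl; ring.
Qed.

Lemma wsum_map {B : Type} (t : B -> A) (L : list B) k f :
  wsum (map t L) k f = wsum L k (fun w => f (map t w)).
Proof.
revert f; induction k as [|k IH]; intros f; simpl; [reflexivity|].
rewrite rsum_map; apply rsum_ext; intros x; apply IH.
Qed.

End Words.

Lemma wsum_combine {A B : Type} (L : list A) (M : list B) k f :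
  wsum L k (fun a => wsum M k (fun b => f (combine a b))) =
  wsum (list_prod L M) k f.
Proof.
revert f; induction k as [|k IH]; intros f; simpl; [reflexivity|].
rewrite rsum_list_prod; apply rsum_ext; intros x.
rewrite wsum_rsum; apply rsum_ext; intros y.
apply (IH (fun w => f ((x, y) :: w))).
Qed.

Lemma rsum_tuples N k f : rsum f (tuples N k) = wsum (seq 0 N) k f.
Proof.
revert f; induction k as [|k IH]; intros f; simpl; [ring|].
rewrite rsum_flat_map; apply rsum_ext; intros x.
now rewrite rsum_map, IH.
Qed.

(** * Poisson thinning *)

(** Every letter of [L] is a Poisson stream of rate [c]. The normalisation exp(- c |L|) is left out,
    so that concatenating lists involves no change of weights. *)
Definition pterm {A : Type} (c : R) (L : list A) (k : nat) (f : list A -> R) : R :=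
  c ^ k / INR (fact k) * wsum L k f.

Section Thinning.
Context {A : Type}.
Implicit Types (f g : list A -> R) (L : list A).

Lemma pterm_ext c L k f g : (forall w, f w = g w) -> pterm c L k f = pterm c L k g.
Proof. intros H; unfold pterm; f_equal; now apply wsum_ext. Qed.

Lemma pterm_scal c L k a f : pterm c L k (fun w => a * f w) = a * pterm c L k f.
Proof. unfold pterm; rewrite wsum_scal; ring. Qed.

Lemma pterm_plus c L k f g :
  pterm c L k (fun w => f w + g w) = pterm c L k f + pterm c L k g.
Proof. unfold pterm; rewrite wsum_plus; ring. Qed.

Lemma pterm_const c L k a :
  pterm c L k (fun _ => a) = (c * INR (length L)) ^ k / INR (fact k) * a.
Proof.
unfold pterm; rewrite wsum_const, Rpow_mult_distr; field; apply INR_fact_neq_0.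
Qed.

Lemma pterm_rsum {B : Type} (M : list B) c L k (f : B -> list A -> R) :
  pterm c L k (fun w => rsum (fun y => f y w) M) = rsum (fun y => pterm c L k (f y)) M.
Proof. unfold pterm; rewrite wsum_rsum, <- rsum_scal; reflexivity. Qed.

Lemma pterm_S c L k f :
  INR (S k) * pterm c L (S k) f =
  c * rsum (fun x => pterm c L k (fun w => f (x :: w))) L.
Proof.
unfold pterm; rewrite rsum_scal; cbn [wsum].
rewrite fact_simpl, mult_INR; simpl (c ^ S k).
field; split; [apply INR_fact_neq_0|apply not_0_INR; discriminate].
Qed.

Lemma pterm_abs_le c L k f M :
  0 <= c -> (forall w, length w = k -> Rabs (f w) <= M) ->
  Rabs (pterm c L k f) <= (c * INR (length L)) ^ k / INR (fact k) * M.
Proof.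
intros Hc H; unfold pterm; rewrite Rabs_mult.
assert (H0 : 0 <= c ^ k / INR (fact k)).
{ apply Rdiv_le_0_compat; [now apply pow_le|apply INR_fact_lt_0]. }
rewrite (Rabs_right _ (Rle_ge _ _ H0)), Rpow_mult_distr.
replace (c ^ k * INR (length L) ^ k / INR (fact k) * M)
  with (c ^ k / INR (fact k) * (INR (length L) ^ k * M))
  by (field; apply INR_fact_neq_0).
apply Rmult_le_compat_l; [exact H0|now apply wsum_abs_le].
Qed.

(** By [pterm_S], multiplying by the length extracts one letter, which acts like a derivation; the
    identity is then a binomial formula proved through a Leibniz rule. *)
Lemma pterm_app c L1 L2 k f :
  (forall v w, Permutation v w -> f v = f w) ->
  pterm c (L1 ++ L2) k f =
  sum_f_R0 (fun j => pterm c L1 j (fun v => pterm c L2 (k - j) (fun w => f (v ++ w)))) k.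
Proof.
revert f; induction k as [|k IH]; intros f Hf.
{ simpl; unfold pterm; simpl; field. }
set (u := fun g j m => pterm c L1 j (fun v => pterm c L2 m (fun w => g (v ++ w)))).
change (pterm c (L1 ++ L2) (S k) f = sum_f_R0 (fun j => u f j (S k - j)%nat) (S k)).
assert (Hl : forall j m, INR (S j) * u f (S j) m =
                  c * rsum (fun x => u (fun w => f (x :: w)) j m) L1).
{ intros j m; unfold u; now rewrite pterm_S. }
(* Invariance of [f] is used here: the letter extracted from the second word has to move in front of
   [v]. *)
assert (Hr : forall j m, INR (S m) * u f j (S m) =
                  c * rsum (fun x => u (fun w => f (x :: w)) j m) L2).
{ intros j m; unfold u; rewrite <- pterm_rsum, <- !pterm_scal.
  apply pterm_ext; intros v; rewrite pterm_S; f_equal.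
  apply rsum_ext; intros x; apply pterm_ext; intros w.
  apply Hf, Permutation_sym, Permutation_middle. }
apply Rmult_eq_reg_l with (INR (S k)); [|apply not_0_INR; discriminate].
rewrite pterm_S, rsum_app, Rmult_plus_distr_l.
assert (Hx : forall x, pterm c (L1 ++ L2) k (fun w => f (x :: w)) =
   sum_f_R0 (fun j => u (fun w => f (x :: w)) j (k - j)%nat) k).
{ intros x; apply IH; intros v w Hvw; apply Hf; now constructor. }
rewrite (rsum_ext _ _ L1 Hx), (rsum_ext _ _ L2 Hx).
assert (Hs : forall L, c * rsum (fun x => sum_f_R0 (fun j => u (fun w => f (x :: w)) j (k - j)%nat) k) L
   = sum_f_R0 (fun j => c * rsum (fun x => u (fun w => f (x :: w)) j (k - j)%nat) L) k).
{ intros L; rewrite rsum_sum_f_R0, scal_sum; apply sum_eq; intros; ring. }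
rewrite !Hs, scal_sum.
(* Writing S k = j + (S k - j) lets the extracted letter come from either the first or the second
   word. *)
transitivity (sum_f_R0 (fun j => INR j * u f j (S k - j)%nat) (S k) +
              sum_f_R0 (fun j => INR (S k - j) * u f j (S k - j)%nat) (S k)).
- f_equal.
  + rewrite (decomp_sum _ (S k)) by lia; simpl (INR 0); rewrite Rmult_0_l, Rplus_0_l.
    apply sum_eq; intros j _; now rewrite <- Hl.
  + rewrite tech5, Nat.sub_diag; simpl (INR 0); rewrite Rmult_0_l, Rplus_0_r.
    apply sum_eq; intros j Hj; rewrite <- Hr.
    now replace (S k - j)%nat with (S (k - j)) by lia.
- rewrite <- plus_sum; apply sum_eq; intros j Hj.
  rewrite minus_INR by lia; ring.
Qed.

End Thinning.

(** * Rearrangement of double series and exponential series *)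

Lemma sum_diagonals (u : nat -> nat -> R) n :
  sum_f_R0 (fun i => sum_f_R0 (fun k => u k (i - k)%nat) i) n =
  sum_f_R0 (fun k => sum_f_R0 (u k) (n - k)) n.
Proof.
induction n as [|n IH]; [reflexivity|].
rewrite tech5, IH, !tech5, Nat.sub_diag, <- Rplus_assoc, <- plus_sum.
simpl (sum_f_R0 (u (S n)) 0); f_equal.
apply sum_eq; intros k Hk.
now replace (S n - k)%nat with (S (n - k)) by lia.
Qed.

Lemma is_series_lim_seq (a : nat -> R) (l : R) :
  is_series a l <-> is_lim_seq (sum_f_R0 a) l.
Proof. rewrite is_series_Reals; symmetry; apply is_lim_seq_Reals. Qed.

Lemma ex_series_dominated (a b : nat -> R) :
  (forall n, Rabs (a n) <= b n) -> ex_series b -> ex_series a.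
Proof. exact (@ex_series_le R_AbsRing R_CompleteNormedModule a b). Qed.

Lemma ex_series_Rmult_l c (a : nat -> R) :
  ex_series a -> ex_series (fun n => c * a n).
Proof. exact (@ex_series_scal R_AbsRing R_NormedModule c a). Qed.

(** A Cauchy product for arrays that are not products themselves: domination by [v k * w m]
    transfers the error estimate from the genuine product of [v] and [w]. *)
Lemma is_series_diagonals (u : nat -> nat -> R) (v w : nat -> R) :
  (forall k, 0 <= v k) -> (forall m, 0 <= w m) ->
  (forall k m, Rabs (u k m) <= v k * w m) -> ex_series v -> ex_series w ->
  (forall k, ex_series (u k)) /\
  ex_series (fun k => Series (u k)) /\
  is_series (fun n => sum_f_R0 (fun k => u k (n - k)%nat) n)
            (Series (fun k => Series (u k))).
Proof.
intros Hv Hw Hu Ev Ew.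
assert (Eu : forall k, ex_series (fun m => Rabs (u k m))).
{ intros k; apply (ex_series_dominated _ (fun m => v k * w m)).
  - intros m; rewrite Rabs_Rabsolu; apply Hu.
  - now apply ex_series_Rmult_l. }
assert (Eu' : forall k, ex_series (u k)) by (intros k; now apply ex_series_Rabs).
assert (Htail : forall k p,
  Rabs (Series (u k) - sum_f_R0 (u k) p) <= v k * (Series w - sum_f_R0 w p)).
{ intros k p.
  rewrite (Series_incr_n (u k) (S p)), (Series_incr_n w (S p)) by (auto; lia).
  simpl pred.
  replace (_ + Series (fun i => u k (S p + i)%nat) - _)
    with (Series (fun i => u k (S p + i)%nat)) by ring.
  replace (_ + Series (fun i => w (S p + i)%nat) - _)
    with (Series (fun i => w (S p + i)%nat)) by ring.
  rewrite <- Series_scal_l.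
  eapply Rle_trans; [apply Series_Rabs|].
  - now apply (ex_series_incr_n (fun m => Rabs (u k m)) (S p)).
  - apply Series_le.
    + intros i; split; [apply Rabs_pos|apply Hu].
    + apply (ex_series_Rmult_l (v k) (fun i => w (S p + i)%nat)).
      now apply (ex_series_incr_n w (S p)). }
assert (Ek : ex_series (fun k => Series (u k))).
{ apply (ex_series_dominated _ (fun k => v k * Series w)).
  - intros k; rewrite <- Series_scal_l.
    eapply Rle_trans; [now apply Series_Rabs|].
    apply Series_le; [intros m; split; [apply Rabs_pos|apply Hu]|].
    now apply (ex_series_Rmult_l (v k) w).
  - now apply (ex_series_scal_r (Series w) v). }
split; [exact Eu'|]; split; [exact Ek|].
assert (Hprod : is_series (fun n => sum_f_R0 (fun k => v k * w (n - k)%nat) n)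
                          (Series v * Series w)).
{ apply is_series_mult; try (now apply Series_correct).
  - apply (ex_series_ext v); [|exact Ev]; intros; now rewrite Rabs_right by (apply Rle_ge, Hv).
  - apply (ex_series_ext w); [|exact Ew]; intros; now rewrite Rabs_right by (apply Rle_ge, Hw). }
pose proof is_series_lim_seq as Hsum.
rewrite Hsum in *.
set (S1 := sum_f_R0 (fun k => Series (u k))).
(* Full rows minus triangle, that is, a sum of row tails. By [Htail] it is at most the same quantity
   for [v k * w m], which tends to 0 by the classical Cauchy product. *)
set (err := fun n => S1 n - sum_f_R0 (fun i => sum_f_R0 (fun k => u k (i - k)%nat) i) n).
assert (Lerr : is_lim_seq err 0).
{ apply is_lim_seq_abs_0.
  apply is_lim_seq_le_le with (u := fun _ => 0)
    (w := fun n => sum_f_R0 v n * Series w -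
                   sum_f_R0 (fun i => sum_f_R0 (fun k => v k * w (i - k)%nat) i) n).
  - intros n; split; [apply Rabs_pos|].
    unfold err, S1; rewrite sum_diagonals, (sum_diagonals (fun k m => v k * w m)).
    rewrite <- minus_sum, (Rmult_comm _ (Series w)), scal_sum, <- minus_sum.
    eapply Rle_trans; [apply sum_f_R0_triangle|].
    apply sum_Rle; intros k _; eapply Rle_trans; [apply Htail|].
    replace (sum_f_R0 (fun m => v k * w m) (n - k)) with (v k * sum_f_R0 w (n - k))
      by (rewrite scal_sum; apply sum_eq; intros; ring).
    lra.
  - apply is_lim_seq_const.
  - replace (Finite 0) with (Finite (Series v * Series w - Series v * Series w))
      by (f_equal; ring).
    apply is_lim_seq_minus'; [|exact Hprod].
    apply (is_lim_seq_mult' _ _ (Series v)); [|apply is_lim_seq_const].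
    now apply Hsum, Series_correct. }
apply is_lim_seq_ext with (fun n => S1 n - err n); [intros; unfold err; ring|].
replace (Finite (Series (fun k => Series (u k))))
  with (Finite (Series (fun k => Series (u k)) - 0)) by (f_equal; ring).
apply is_lim_seq_minus'; [|exact Lerr].
now apply Hsum, Series_correct.
Qed.

Lemma is_series_exp x : is_series (fun k => x ^ k / INR (fact k)) (exp x).
Proof.
apply is_series_ext with (fun k => scal (pow_n x k) (/ INR (fact k))).
- intros k; now rewrite pow_n_pow.
- apply is_exp_Reals.
Qed.

Lemma ex_series_exp x : ex_series (fun k => x ^ k / INR (fact k)).
Proof. eexists; apply is_series_exp. Qed.

Lemma Series_exp x : Series (fun k => x ^ k / INR (fact k)) = exp x.
Proof. apply is_series_unique, is_series_exp. Qed.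

Lemma is_series_exp_mean x :
  is_series (fun k => x ^ k / INR (fact k) * INR k) (x * exp x).
Proof.
apply is_series_decr_1; simpl (INR 0).
replace (plus (x * exp x) _) with (x * exp x)
  by (unfold plus, opp; simpl; ring).
apply is_series_ext with (fun k => scal x (x ^ k / INR (fact k))).
- intros k.
  change (x * (x ^ k / INR (fact k)) = x * x ^ k / INR (fact (S k)) * INR (S k)).
  rewrite fact_simpl, mult_INR.
  field; split; [apply INR_fact_neq_0|apply not_0_INR; discriminate].
- apply (@is_series_scal R_AbsRing R_NormedModule), is_series_exp.
Qed.

Lemma exp_term_ge0 x k : 0 <= x -> 0 <= x ^ k / INR (fact k).
Proof.
intros Hx; apply Rdiv_le_0_compat; [now apply pow_le|apply INR_fact_lt_0].
Qed.

Section PoissonSeries.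
Context {A : Type}.
Implicit Types (f : list A -> R) (L : list A).

(** A geometric bound is beaten by 1/k!, and D^(j+m) = D^j D^m splits the bound on [v ++ w] into the
    product form that [is_series_diagonals] requires. *)
Definition exp_growth f :=
  exists C D, 0 <= C /\ 0 <= D /\ forall w, Rabs (f w) <= C * D ^ length w.

Lemma ex_series_pterm c L f : 0 <= c -> exp_growth f ->
  ex_series (fun k => pterm c L k f).
Proof.
intros Hc (C & D & HC & HD & Hf).
apply ex_series_dominated with
  (fun k => C * ((c * INR (length L) * D) ^ k / INR (fact k))).
- intros k; eapply Rle_trans.
  + apply pterm_abs_le with (M := C * D ^ k); [exact Hc|].
    intros w <-; apply Hf.
  + rewrite (Rpow_mult_distr _ D); apply Req_le; field; apply INR_fact_neq_0.
- apply ex_series_Rmult_l, ex_series_exp.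
Qed.

Lemma is_series_pterm_app c L1 L2 f : 0 <= c -> exp_growth f ->
  (forall v w, Permutation v w -> f v = f w) ->
  let u j m := pterm c L1 j (fun v => pterm c L2 m (fun w => f (v ++ w))) in
  (forall j, ex_series (u j)) /\
  ex_series (fun j => Series (u j)) /\
  is_series (fun k => pterm c (L1 ++ L2) k f) (Series (fun j => Series (u j))).
Proof.
intros Hc (C & D & HC & HD & Hf) Hperm u.
assert (Hl : forall L, 0 <= c * INR (length L)).
{ intros L; apply Rmult_le_pos; [exact Hc|apply pos_INR]. }
destruct (is_series_diagonals u
  (fun j => C * ((c * INR (length L1) * D) ^ j / INR (fact j)))
  (fun m => (c * INR (length L2) * D) ^ m / INR (fact m))) as (E' & E & S).
- intros j; apply Rmult_le_pos; [exact HC|apply exp_term_ge0].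
  now apply Rmult_le_pos.
- intros m; apply exp_term_ge0; now apply Rmult_le_pos.
- intros j m; eapply Rle_trans.
  + apply pterm_abs_le
      with (M := (c * INR (length L2)) ^ m / INR (fact m) * (C * D ^ (j + m)));
      [exact Hc|].
    intros v Hv; apply pterm_abs_le; [exact Hc|].
    intros w Hw; rewrite <- Hv, <- Hw, <- length_app; apply Hf.
  + rewrite !(Rpow_mult_distr _ D), pow_add; apply Req_le; field.
    split; apply INR_fact_neq_0.
- apply ex_series_Rmult_l, ex_series_exp.
- apply ex_series_exp.
- split; [exact E'|]; split; [exact E|].
  apply is_series_ext with (2 := S); intros k; symmetry.
  now apply pterm_app.
Qed.

(** A letter that only adds [b] per occurrence contributes [b] times its Poisson mean [c]; the
    exponentials are the omitted normalisations. *)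
Lemma Series_pterm_singleton c L a b f : 0 <= c -> exp_growth f ->
  (forall v w, Permutation v w -> f v = f w) ->
  (forall w l, f (w ++ repeat a l) = f w + b * INR l) ->
  Series (fun k => pterm c (L ++ [a]) k f) =
  exp c * Series (fun k => pterm c L k f) + b * c * exp c * exp (c * INR (length L)).
Proof.
intros Hc Hg Hperm Ha.
destruct (is_series_pterm_app c L [a] f Hc Hg Hperm) as (_ & _ & S).
rewrite (is_series_unique _ _ S).
rewrite <- (Series_exp (c * INR (length L))), <- !Series_scal_l, <- Series_plus.
- apply Series_ext; intros j; apply is_series_unique.
  set (P := pterm c L j f); set (x := c * INR (length L)).
  apply is_series_ext with
    (fun m => plus (scal P (c ^ m / INR (fact m)))
       (scal (b * (x ^ j / INR (fact j))) (c ^ m / INR (fact m) * INR m))).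
  + intros m.
    rewrite (pterm_ext _ _ _ _ (fun v => c ^ m / INR (fact m) * f v +
               c ^ m / INR (fact m) * (b * INR m))).
    * rewrite pterm_plus, pterm_scal, pterm_const.
      fold x P; unfold plus, scal; simpl; unfold mult; simpl; ring.
    * intros v; unfold pterm; rewrite wsum_singleton, Ha; ring.
  + replace (exp c * P + b * c * exp c * (x ^ j / INR (fact j))) with
      (plus (scal P (exp c)) (scal (b * (x ^ j / INR (fact j))) (c * exp c)))
      by (unfold plus, scal; simpl; unfold mult; simpl; ring).
    apply (@is_series_plus R_AbsRing R_NormedModule);
      apply (@is_series_scal R_AbsRing R_NormedModule).
    * apply is_series_exp.
    * apply is_series_exp_mean.
- apply ex_series_Rmult_l; now apply ex_series_pterm.
- apply ex_series_Rmult_l, ex_series_exp.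
Qed.

End PoissonSeries.

(** [series] chooses its value by [epsilon], so it is known only once convergence is established;
    this is why every rewriting of an expectation carries a summability proof. *)
Lemma series_unique (u : nat -> R) l : is_series u l -> series u = l.
Proof.
rewrite is_series_Reals; intros H.
assert (H' : Un_cv (sum_f_R0 u) (series u)).
{ exact (epsilon_spec (inhabits 0) (Un_cv (sum_f_R0 u)) (ex_intro _ l H)). }
exact (UL_sequence _ _ _ H' H).
Qed.

(** * Partition functions as functions of a list of interactions *)

(** One alphabet for all interactions, so that a realization of the disorder is a single word and
    thinning applies to it. [Unit] is the bond of the new spin with itself. *)
Inductive event := Bond (i j : nat) | Field (i : nat) | Unit.

Definition ev (e : event) (s : list R) : R :=
  match e with
  | Bond i j => nth i s 0 * nth j s 0
  | Field i => nth i s 0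
  | Unit => 1
  end.

Definition energy (w : list event) (s : list R) : R := rsum (fun e => ev e s) w.

Definition partition_fun (N : nat) (beta : R) (w : list event) : R :=
  rsum (fun s => exp (beta * energy w s)) (spins N).

Definition pressure (N : nat) (beta : R) (w : list event) : R :=
  ln (partition_fun N beta w).

Definition bond (p : nat * nat) : event := Bond (fst p) (snd p).
Definition bonds (N : nat) : list event := map bond (list_prod (seq 0 N) (seq 0 N)).
Definition fields (N : nat) : list event := map Field (seq 0 N).

Lemma rsum_spins_S N h :
  rsum h (spins (S N)) = rsum (fun s => h (1 :: s) + h (-1 :: s)) (spins N).
Proof.
simpl; rewrite rsum_flat_map; apply rsum_ext; intros s; simpl; ring.
Qed.

Lemma spins_values N s : In s (spins N) -> List.Forall (fun x => x = 1 \/ x = -1) s.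
Proof.
revert s; induction N as [|N IH]; simpl; intros s.
- intros [<-|[]]; constructor.
- rewrite in_flat_map; intros (t & Ht & [<-|[<-|[]]]); constructor; auto.
Qed.

Lemma spins_length N s : In s (spins N) -> length s = N.
Proof.
revert s; induction N as [|N IH]; simpl; intros s.
- now intros [<-|[]].
- rewrite in_flat_map; intros (t & Ht & [<-|[<-|[]]]); simpl; auto.
Qed.

Lemma spin_value N s i : In s (spins N) ->
  nth i s 0 = 1 \/ nth i s 0 = -1 \/ nth i s 0 = 0.
Proof.
intros Hs; destruct (le_lt_dec (length s) i) as [H|H].
- right; right; now apply nth_overflow.
- destruct (proj1 (Forall_forall _ _) (spins_values _ _ Hs) _ (nth_In s 0 H)); auto.
Qed.

Lemma ev_value N s e : In s (spins N) -> ev e s = 1 \/ ev e s = -1 \/ ev e s = 0.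
Proof.
intros Hs; destruct e as [i j|i|]; simpl; auto.
- destruct (spin_value N s i Hs) as [->|[->| ->]],
    (spin_value N s j Hs) as [->|[->| ->]]; lra.
- exact (spin_value N s i Hs).
Qed.

Lemma energy_app v w s : energy (v ++ w) s = energy v s + energy w s.
Proof. apply rsum_app. Qed.

Lemma energy_perm v w s : Permutation v w -> energy v s = energy w s.
Proof. unfold energy; induction 1; simpl; lra. Qed.

Lemma energy_abs N w s : In s (spins N) -> Rabs (energy w s) <= INR (length w).
Proof.
intros Hs; unfold energy; eapply Rle_trans; [apply rsum_abs|].
rewrite <- (Rmult_1_r (INR _)), <- (rsum_const 1 w).
apply rsum_le; intros e _; unfold Rabs; destruct Rcase_abs;
  destruct (ev_value N s e Hs) as [H|[H|H]]; lra.
Qed.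

Lemma pressure_perm N beta v w :
  Permutation v w -> pressure N beta v = pressure N beta w.
Proof.
intros H; unfold pressure, partition_fun; f_equal; apply rsum_ext; intros s.
now rewrite (energy_perm v w s H).
Qed.

Lemma length_spins N : INR (length (spins N)) = 2 ^ N.
Proof.
rewrite <- (Rmult_1_r (INR _)), <- (rsum_const 1 (spins N)).
induction N as [|N IH]; [simpl; ring|].
rewrite rsum_spins_S, rsum_plus, IH; simpl; ring.
Qed.

Lemma exp_le x y : x <= y -> exp x <= exp y.
Proof.
intros [H| ->]; [apply Rlt_le, exp_increasing, H|apply Rle_refl].
Qed.

Lemma partition_fun_bounds N beta w : 0 <= beta ->
  2 ^ N * exp (- (beta * INR (length w))) <= partition_fun N beta w <=
  2 ^ N * exp (beta * INR (length w)).
Proof.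
intros Hb; rewrite <- length_spins, <- !rsum_const; unfold partition_fun.
split; apply rsum_le; intros s Hs; apply exp_le;
  pose proof (energy_abs N w s Hs) as H; apply Rabs_le_between in H; nra.
Qed.

Lemma partition_fun_pos N beta w : 0 <= beta -> 0 < partition_fun N beta w.
Proof.
intros Hb; eapply Rlt_le_trans; [|apply partition_fun_bounds, Hb].
apply Rmult_lt_0_compat; [apply pow_lt; lra|apply exp_pos].
Qed.

Lemma pressure_growth N beta : 0 < beta -> exp_growth (pressure N beta).
Proof.
intros Hb; exists (INR N * ln 2 + 1), (1 + beta).
assert (H2 : 0 < ln 2) by (rewrite <- ln_1; apply ln_increasing; lra).
assert (HN := pos_INR N).
assert (HNl : 0 <= INR N * ln 2) by nra.
split; [lra|]; split; [lra|]; intros w.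
pose proof (partition_fun_bounds N beta w (Rlt_le _ _ Hb)) as [B1 B2].
pose proof (partition_fun_pos N beta w (Rlt_le _ _ Hb)) as Bp.
assert (P : 0 < 2 ^ N) by (apply pow_lt; lra).
apply ln_le in B1; [|apply Rmult_lt_0_compat; [exact P|apply exp_pos]].
apply ln_le in B2; [|exact Bp].
rewrite ln_mult, ln_exp, ln_pow in B1 by (try apply exp_pos; lra).
rewrite ln_mult, ln_exp, ln_pow in B2 by (try apply exp_pos; lra).
fold (pressure N beta w) in B1, B2.
(* Bernoulli's inequality turns the linear bound N ln 2 + beta |w| into a geometric one; this is the
   origin of the constants C = N ln 2 + 1 and D = 1 + beta. *)
pose proof (poly (length w) beta Hb) as Hp.
pose proof (pos_INR (length w)) as Hw.
assert (0 <= INR (length w) * beta) by nra.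
assert (INR N * ln 2 * 1 <= INR N * ln 2 * (1 + beta) ^ length w)
  by (apply Rmult_le_compat_l; lra).
apply Rabs_le; split; lra.
Qed.

Lemma pressure_Unit N beta w l : 0 <= beta ->
  pressure N beta (w ++ repeat Unit l) = pressure N beta w + beta * INR l.
Proof.
intros Hb; unfold pressure.
replace (partition_fun N beta (w ++ repeat Unit l))
  with (partition_fun N beta w * exp (beta * INR l)).
{ rewrite ln_mult, ln_exp; auto using partition_fun_pos, exp_pos. }
unfold partition_fun; rewrite Rmult_comm, <- rsum_scal.
apply rsum_ext; intros s; rewrite <- exp_plus, energy_app; f_equal.
replace (energy (repeat Unit l) s) with (INR l); [ring|].
induction l as [|l IH]; [reflexivity|].
rewrite S_INR; unfold energy in *; simpl in *; rewrite <- IH; ring.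
Qed.

Lemma Zb_partition_fun N beta is js :
  Zb N beta is js = partition_fun N beta (map bond (combine is js)).
Proof.
apply rsum_ext; intros s; unfold energy; now rewrite rsum_map.
Qed.

Lemma Zt_partition_fun N beta is js ks :
  Zt N beta is js ks =
  partition_fun N beta (map bond (combine is js) ++ map Field ks).
Proof.
apply rsum_ext; intros s; rewrite energy_app; unfold energy.
rewrite !rsum_map, Rmult_plus_distr_l; reflexivity.
Qed.

(** * Gauging away one spin *)

Fixpoint smul (s t : list R) : list R :=
  match s, t with
  | x :: s', y :: t' => x * y :: smul s' t'
  | _, _ => []
  end.

Lemma nth_smul i s t : nth i (smul s t) 0 = nth i s 0 * nth i t 0.
Proof.
revert i t; induction s as [|x s IH]; intros [|i] [|y t]; simpl; try ring.
apply IH.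
Qed.

Lemma ev_smul e s t : ev e (smul s t) = ev e s * ev e t.
Proof. destruct e; simpl; rewrite ?nth_smul; ring. Qed.

(** Configurations form the group {1,-1}^N under [smul], and translation by [t] permutes it: in each
    coordinate it fixes or exchanges the two signs. *)
Lemma rsum_spins_smul N t h : In t (spins N) ->
  rsum (fun s => h (smul s t)) (spins N) = rsum h (spins N).
Proof.
revert t h; induction N as [|N IH]; intros t h.
{ intros [<-|[]]; reflexivity. }
intros Ht; simpl in Ht; apply in_flat_map in Ht.
destruct Ht as (t' & Ht' & Ht).
assert (exists y, t = y :: t' /\ (y = 1 \/ y = -1)) as (y & -> & Hy).
{ destruct Ht as [<-|[<-|[]]]; eauto. }
rewrite !rsum_spins_S; simpl.
rewrite <- (IH t' (fun s => h (1 :: s) + h (-1 :: s)) Ht').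
apply rsum_ext; intros s.
destruct Hy as [-> | ->].
- now replace (1 * 1) with 1 by ring; replace (-1 * 1) with (-1) by ring.
- replace (1 * -1) with (-1) by ring; replace (-1 * -1) with 1 by ring; ring.
Qed.

Definition gauge (p : nat * nat) : event :=
  match p with
  | (O, O) => Unit
  | (O, S i) | (S i, O) => Field i
  | (S i, S j) => Bond i j
  end.

Lemma ev_bond_gauge x s p N : x = 1 \/ x = -1 -> length s = N ->
  ev (bond p) (x :: smul s (repeat x N)) = ev (gauge p) s.
Proof.
intros Hx HN; assert (Hxx : x * x = 1) by (destruct Hx as [-> | ->]; ring).
(* Beyond the N sites both sides are the default 0; inside, x * x = 1. *)
assert (Hn : forall i, x * (nth i s 0 * nth i (repeat x N) 0) = nth i s 0).
{ intros i; destruct (le_lt_dec N i) as [Hi|Hi].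
  - rewrite (nth_overflow s) by lia; ring.
  - rewrite (nth_indep (repeat x N) 0 x) by (rewrite repeat_length; lia).
    rewrite nth_repeat; transitivity (x * x * nth i s 0); [ring|rewrite Hxx; ring]. }
destruct p as [[|i] [|j]]; simpl; rewrite ?nth_smul.
- exact Hxx.
- apply Hn.
- rewrite Rmult_comm; apply Hn.
- rewrite <- (Hn i), <- (Hn j) at 2.
  transitivity (x * x * (nth i s 0 * nth i (repeat x N) 0 * (nth j s 0 * nth j (repeat x N) 0)));
    [rewrite Hxx|]; ring.
Qed.

Lemma repeat_spins N x : x = 1 \/ x = -1 -> In (repeat x N) (spins N).
Proof.
intros Hx; induction N as [|N IH]; simpl; [now left|].
apply in_flat_map; exists (repeat x N); split; [exact IH|].
destruct Hx as [-> | ->]; simpl; auto.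
Qed.

(** For either value x of the new spin, multiplying all the other spins by x removes x from every
    bond, so the two half sums coincide. *)
Lemma partition_fun_gauge N beta w :
  partition_fun (S N) beta (map bond w) = 2 * partition_fun N beta (map gauge w).
Proof.
unfold partition_fun; rewrite rsum_spins_S, rsum_plus.
assert (H : forall x, x = 1 \/ x = -1 ->
  rsum (fun s => exp (beta * energy (map bond w) (x :: s))) (spins N) =
  rsum (fun s => exp (beta * energy (map gauge w) s)) (spins N)).
{ intros x Hx.
  rewrite <- (rsum_spins_smul N (repeat x N)) by now apply repeat_spins.
  apply rsum_ext_in; intros s Hs; do 2 f_equal.
  unfold energy; rewrite !rsum_map; apply rsum_ext; intros p.
  now apply ev_bond_gauge; [|apply spins_length]. }
rewrite !H by auto; ring.
Qed.

(** Equality of two multisets of events, stated through sums because that is the form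
    [wsum_functional] consumes. Fields occur twice since the new spin may be either end of an
    ordered pair. *)
Lemma rsum_gauge N h :
  rsum h (map gauge (list_prod (seq 0 (S N)) (seq 0 (S N)))) =
  rsum h ((bonds N ++ (fields N ++ fields N)) ++ [Unit]).
Proof.
unfold bonds, fields; rewrite !rsum_app, !rsum_map, !rsum_list_prod.
simpl seq; rewrite <- !seq_shift; simpl.
rewrite !rsum_map, !rsum_plus; simpl.
rewrite (rsum_ext
  (fun x => rsum (fun y => h match y with O => Field x | S j => Bond x j end)
                 (map S (seq 0 N)))
  (fun x => rsum (fun y => h (Bond x y)) (seq 0 N))).
- unfold bond; simpl; ring.
- intros i; now rewrite rsum_map.
Qed.

(** * Expectations as Poisson series over words, and the cavity recursion *)

Lemma avg_idx_wsum N k f : avg_idx N k f = wsum (seq 0 N) k f / INR N ^ k.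
Proof. unfold avg_idx; now rewrite rsum_tuples. Qed.

Lemma avg_bonds N k (f : list nat -> list nat -> R) h :
  (forall is js, f is js = h (map bond (combine is js))) ->
  avg_idx N k (fun is => avg_idx N k (f is)) =
  wsum (bonds N) k h / (INR N ^ k * INR N ^ k).
Proof.
intros Hf; rewrite avg_idx_wsum.
rewrite (wsum_ext _ _ _ (fun is => / INR N ^ k *
  wsum (seq 0 N) k (fun js => h (map bond (combine is js))))).
- rewrite wsum_scal, (wsum_combine _ _ _ (fun w => h (map bond w))).
  unfold bonds; rewrite wsum_map; unfold Rdiv; rewrite Rinv_mult; ring.
- intros is; rewrite avg_idx_wsum; unfold Rdiv; rewrite Rmult_comm; f_equal.
  apply wsum_ext, Hf.
Qed.

Lemma length_bonds N : INR (length (bonds N)) = INR N * INR N.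
Proof. unfold bonds; now rewrite length_map, length_prod, !length_seq, mult_INR. Qed.

Lemma length_fields N : INR (length (fields N)) = INR N.
Proof. unfold fields; now rewrite length_map, length_seq. Qed.

Lemma total_pressure_series N beta a : (0 < N)%nat -> 0 < beta -> 0 <= a ->
  INR N * A_N N a beta =
  exp (- (a * INR N)) *
  Series (fun k => pterm (a / INR N) (bonds N) k (pressure N beta)).
Proof.
intros HN Hbeta Ha; assert (n_pos : 0 < INR N) by now apply lt_0_INR.
unfold A_N; rewrite <- Rmult_assoc, Rinv_r, Rmult_1_l by lra.
apply series_unique.
apply is_series_ext with
  (fun k => scal (exp (- (a * INR N))) (pterm (a / INR N) (bonds N) k (pressure N beta))).
- intros k; rewrite (avg_bonds _ _ _ (pressure N beta)).
  + unfold poisson, pterm, Rdiv; rewrite !Rpow_mult_distr, pow_inv.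
    unfold scal; simpl; unfold mult; simpl.
    field; split; [apply pow_nonzero; lra|apply INR_fact_neq_0].
  + intros is js; unfold pressure; now rewrite Zb_partition_fun.
- apply (@is_series_scal R_AbsRing R_NormedModule), Series_correct.
  apply ex_series_pterm; [apply Rdiv_le_0_compat; lra|now apply pressure_growth].
Qed.

Lemma Psi_N_series N beta a : (0 < N)%nat -> 0 < beta -> 0 < a ->
  Psi_N N a beta 1 =
  exp (- (a * INR N)) * exp (- (2 * a)) *
    Series (fun j => Series (fun m =>
      pterm (a / INR N) (bonds N) j (fun v =>
        pterm (a / INR N) (fields N ++ fields N) m (fun w => pressure N beta (v ++ w)))))
  - INR N * A_N N a beta.
Proof.
intros HN Hbeta Ha; assert (n_pos : 0 < INR N) by now apply lt_0_INR.
set (c := a / INR N).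
assert (Hc : 0 < c) by (apply Rdiv_lt_0_compat; lra).
rewrite total_pressure_series by (assumption || lra); fold c.
set (u := fun j m => pterm c (bonds N) j (fun v =>
        pterm c (fields N ++ fields N) m (fun w => pressure N beta (v ++ w)))).
destruct (is_series_pterm_app c (bonds N) (fields N ++ fields N) (pressure N beta))
  as (Eu & EU & _); [lra|now apply pressure_growth|apply pressure_perm|].
fold u in Eu, EU.
assert (EP : ex_series (fun k => pterm c (bonds N) k (pressure N beta)))
  by (apply ex_series_pterm; [lra|now apply pressure_growth]).
unfold Psi_N; apply series_unique.
apply is_series_ext with (fun k =>
  plus (scal (exp (- (a * INR N)) * exp (- (2 * a))) (Series (u k)))
       (scal (- exp (- (a * INR N))) (pterm c (bonds N) k (pressure N beta)))).
2: { replace (_ - _) with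
      (plus (scal (exp (- (a * INR N)) * exp (- (2 * a))) (Series (fun j => Series (u j))))
        (scal (- exp (- (a * INR N))) (Series (fun k => pterm c (bonds N) k (pressure N beta)))))
      by (unfold plus, scal; simpl; unfold mult; simpl; unfold u; ring).
  apply (@is_series_plus R_AbsRing R_NormedModule);
    apply (@is_series_scal R_AbsRing R_NormedModule); now apply Series_correct. }
intros k.
pose proof (INR_fact_neq_0 k) as Hk.
assert (Hck : c ^ k <> 0) by (apply pow_nonzero; lra).
assert (Hnk : forall i, INR N ^ i <> 0) by (intros; apply pow_nonzero; lra).
set (P := pterm c (bonds N) k (pressure N beta)).
(* [q] converts the weight c^k / k! of [pterm] back into the uniform average over the N^(2k) words
   of bonds. *)
set (q := INR (fact k) / (c ^ k * (INR N ^ k * INR N ^ k))).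
rewrite (series_unique _ (q * (exp (- (2 * a)) * Series (u k) - P))).
{ assert (Hp : poisson (a * INR N) k =
    exp (- (a * INR N)) * (c ^ k * INR N ^ k * INR N ^ k / INR (fact k))).
  { unfold poisson; rewrite <- !Rpow_mult_distr.
    replace (c * INR N * INR N) with (a * INR N) by (unfold c; field; lra).
    unfold Rdiv; ring. }
  rewrite Hp; unfold q, plus, scal; simpl; unfold mult; simpl; field; auto. }
apply is_series_ext with (fun m =>
  plus (scal (q * exp (- (2 * a))) (u k m))
       (scal (- q * P * exp (- (2 * a))) ((2 * a) ^ m / INR (fact m)))).
- intros m; pose proof (INR_fact_neq_0 m) as Hm.
  rewrite (avg_bonds _ _ _ (fun v =>
    / INR N ^ m * wsum (fields N) m (fun w => pressure N beta (v ++ w)) - pressure N beta v)).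
  + rewrite (wsum_ext _ _ _ (fun v => / INR N ^ m *
       wsum (fields N) m (fun w => pressure N beta (v ++ w)) + (- 1) * pressure N beta v))
      by (intros; ring).
    rewrite wsum_plus, !wsum_scal.
    unfold u, P, pterm.
    (* The doubled list of fields supplies the factor 2^m of (2 a)^m = 2^m (c N)^m. *)
    rewrite (wsum_ext _ _
      (fun v => c ^ m / INR (fact m) *
         wsum (fields N ++ fields N) m (fun w => pressure N beta (v ++ w)))
      (fun v => c ^ m / INR (fact m) * 2 ^ m *
         wsum (fields N) m (fun w => pressure N beta (v ++ w))))
      by (intros; rewrite wsum_double; ring).
    rewrite wsum_scal; unfold poisson, q.
    replace (2 * a * 1) with (2 * a) by ring.
    replace (2 * a) with (2 * (c * INR N)) by (unfold c; field; lra).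
    rewrite !Rpow_mult_distr.
    unfold plus, scal; simpl; unfold mult; simpl; field; auto.
  + intros is js; rewrite avg_idx_wsum; unfold fields; rewrite wsum_map.
    unfold Rdiv; rewrite Rmult_comm.
    rewrite (wsum_ext _ _ _ (fun ks => pressure N beta (map bond (combine is js) ++ map Field ks)
                + - pressure N beta (map bond (combine is js)))).
    * rewrite wsum_plus, wsum_const, length_seq; field; auto.
    * intros ks; rewrite Zb_partition_fun, Zt_partition_fun.
      apply ln_div; apply partition_fun_pos; lra.
- replace (q * (exp (- (2 * a)) * Series (u k) - P)) with
    (plus (scal (q * exp (- (2 * a))) (Series (u k)))
       (scal (- q * P * exp (- (2 * a))) (exp (2 * a)))).
  + apply (@is_series_plus R_AbsRing R_NormedModule);
      apply (@is_series_scal R_AbsRing R_NormedModule).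
    * apply Series_correct, Eu.
    * apply is_series_exp.
  + unfold plus, scal; simpl; unfold mult; simpl.
    transitivity (q * exp (- (2 * a)) * Series (u k) - q * P * (exp (- (2 * a)) * exp (2 * a)));
      [ring|].
    rewrite <- exp_plus, Rplus_opp_l, exp_0; ring.
Qed.

Lemma cavity_recursion N a beta : (0 < N)%nat -> 0 < a -> 0 < beta ->
  INR (S N) * A_N (S N) a beta =
  ln 2 + beta * (a / INR (S N)) +
  INR N * A_N N (alpha_tilde N a) beta + Psi_N N (alpha_tilde N a) beta 1.
Proof.
intros HN Ha Hb.
assert (Hn : 0 < INR N) by now apply lt_0_INR.
assert (Hn1 : 0 < INR (S N)) by (apply lt_0_INR; lia).
set (c := a / INR (S N)).
assert (Hc : 0 < c) by (apply Rdiv_lt_0_compat; lra).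
(* Both systems have the same rate [c] per ordered pair, so one [pterm] parameter serves
   throughout. *)
assert (Et : alpha_tilde N a = c * INR N).
{ unfold alpha_tilde, c; rewrite Nat.add_1_r; field; lra. }
assert (Ht : 0 < c * INR N) by nra.
rewrite Et, Psi_N_series, total_pressure_series by (auto; lra || lia).
replace (c * INR N / INR N) with c by (field; lra); fold c.
set (L := bonds N ++ (fields N ++ fields N)).
assert (HL : INR (length L) = INR N * INR N + 2 * INR N).
{ unfold L; rewrite !length_app, !plus_INR, length_bonds, length_fields; ring. }
pose proof (S_INR N) as HS.
destruct (is_series_pterm_app c (bonds N) (fields N ++ fields N) (pressure N beta))
  as (_ & _ & SU); [lra|now apply pressure_growth|apply pressure_perm|].
apply is_series_unique in SU; fold L in SU; rewrite <- SU; clear SU.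
rewrite (Series_ext _ (fun k =>
  ln 2 * ((a * INR (S N)) ^ k / INR (fact k)) + pterm c (L ++ [Unit]) k (pressure N beta))).
- rewrite Series_plus, Series_scal_l, Series_exp.
  + rewrite (Series_pterm_singleton c L Unit beta); try lra.
    * set (X := Series _).
      assert (E1 : exp (- (a * INR (S N))) * exp (a * INR (S N)) = 1)
        by (rewrite <- exp_plus, Rplus_opp_l; apply exp_0).
      (* [E2] and [E3] both express a (N+1) = c (N+1)^2 = c N^2 + 2 c N + c. *)
      assert (E2 : exp (- (a * INR (S N))) * exp c * exp (c * INR (length L)) = 1).
      { rewrite <- !exp_plus, <- exp_0; f_equal; rewrite HL; unfold c; rewrite HS.
        field; lra. }
      assert (E3 : exp (- (a * INR (S N))) * exp c =
                   exp (- (c * INR N * INR N)) * exp (- (2 * (c * INR N)))).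
      { rewrite <- !exp_plus; f_equal; unfold c; rewrite HS; field; lra. }
      rewrite <- E3.
      transitivity (ln 2 * (exp (- (a * INR (S N))) * exp (a * INR (S N))) +
        exp (- (a * INR (S N))) * exp c * X +
        beta * c * (exp (- (a * INR (S N))) * exp c * exp (c * INR (length L)))); [ring|].
      rewrite E1, E2; unfold Rminus; fold (INR N); ring.
    * now apply pressure_growth.
    * apply pressure_perm.
    * intros w l; apply pressure_Unit; lra.
  + apply ex_series_Rmult_l, ex_series_exp.
  + apply ex_series_pterm; [lra|now apply pressure_growth].
- intros k; unfold pterm at 1, bonds; fold c; rewrite wsum_map.
  rewrite (wsum_ext _ _ _ (fun w => ln 2 + pressure N beta (map gauge w))).
  + rewrite <- (wsum_map gauge _ k (fun w => ln 2 + pressure N beta w)).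
    rewrite (wsum_functional _ _ _ _ (rsum_gauge N)); fold L.
    change (pterm c (L ++ [Unit]) k (fun w => ln 2 + pressure N beta w) =
      ln 2 * ((a * INR (S N)) ^ k / INR (fact k)) + pterm c (L ++ [Unit]) k (pressure N beta)).
    rewrite pterm_plus, pterm_const, length_app, plus_INR, HL; simpl (INR (length [Unit])).
    replace (c * (INR N * INR N + 2 * INR N + 1)) with (a * INR (S N))
      by (unfold c; rewrite HS; field; lra).
    ring.
  + intros w; unfold pressure; rewrite partition_fun_gauge, ln_mult; auto.
    lra. apply partition_fun_pos; lra.
Qed.

(** * Griffiths inequalities and convexity in the connectivity *)

(** Orthogonality of characters: if chi t differs from 1 for some t, translation by t gives S = chi
    t * S and the sum S vanishes; otherwise every term is 1. *)
Lemma rsum_character_ge0 N (chi : list R -> R) :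
  (forall s t, chi (smul s t) = chi s * chi t) -> 0 <= rsum chi (spins N).
Proof.
intros Hchi; destruct (classic (exists t, In t (spins N) /\ chi t <> 1)) as [(t & Ht & H1)|H].
- assert (E : rsum chi (spins N) = chi t * rsum chi (spins N)).
  { rewrite <- (rsum_spins_smul N t chi Ht) at 1; rewrite <- rsum_scal.
    apply rsum_ext; intros s; rewrite Hchi; ring. }
  apply Req_le; symmetry; apply Rmult_eq_reg_l with (1 - chi t); lra.
- apply rsum_ge0; intros t Ht.
  destruct (Req_dec (chi t) 1) as [E|E]; [lra|exfalso; apply H; eauto].
Qed.

Lemma cosh_ge1 x : 1 <= cosh x.
Proof.
unfold cosh; assert (E : exp x * exp (- x) = 1) by (rewrite <- exp_plus, Rplus_opp_r; apply exp_0).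
pose proof (exp_pos x); pose proof (exp_pos (- x)).
pose proof (pow2_ge_0 (exp x - exp (- x))); nra.
Qed.

Lemma sinh_ge0 x : 0 <= x -> 0 <= sinh x.
Proof. intros Hx; unfold sinh; pose proof (exp_le (- x) x); lra. Qed.

(** Interpolation on three points; 0 is the value read at an index outside the system. For J >= 0
    the coefficients are nonnegative, as the Griffiths inequalities require. *)
Lemma exp_spin_expansion J x : x = 1 \/ x = -1 \/ x = 0 ->
  exp (J * x) = 1 + x * sinh J + x * x * (cosh J - 1).
Proof.
intros [->|[->| ->]]; unfold sinh, cosh.
- rewrite Rmult_1_r; field.
- replace (J * -1) with (- J) by ring; field.
- rewrite Rmult_0_r, exp_0; ring.
Qed.

Lemma smul_comm s t : smul s t = smul t s.
Proof.
revert t; induction s as [|x s IH]; intros [|y t]; simpl; try reflexivity.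
now rewrite IH, Rmult_comm.
Qed.

(** An arbitrary multiplicative [chi] makes the induction close: expanding one Boltzmann factor
    replaces [chi] by its products with [ev e] and with its square, with nonnegative weights. *)
Lemma griffiths_first N (l : list (R * event)) (chi : list R -> R) :
  (forall p, In p l -> 0 <= fst p) ->
  (forall s t, chi (smul s t) = chi s * chi t) ->
  0 <= rsum (fun s => chi s * exp (rsum (fun p => fst p * ev (snd p) s) l)) (spins N).
Proof.
revert chi; induction l as [|[J e] l IH]; intros chi Hl Hchi.
{ rewrite (rsum_ext _ chi) by (intros; simpl; rewrite exp_0; ring).
  now apply rsum_character_ge0. }
assert (HJ : 0 <= J) by apply (Hl (J, e)), in_eq.
assert (Hl' : forall p, In p l -> 0 <= fst p) by (intros; apply Hl; now right).
set (E := fun s => exp (rsum (fun p => fst p * ev (snd p) s) l)).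
rewrite (rsum_ext_in _ (fun s => chi s * E s + (sinh J * (chi s * ev e s * E s) +
   (cosh J - 1) * (chi s * ev e s * ev e s * E s)))).
- rewrite !rsum_plus, !rsum_scal.
  pose proof (cosh_ge1 J); pose proof (sinh_ge0 J HJ).
  apply Rplus_le_le_0_compat; [now apply IH|].
  apply Rplus_le_le_0_compat; apply Rmult_le_pos; try lra.
  + apply (IH (fun s => chi s * ev e s)); [exact Hl'|].
    intros s t; rewrite Hchi, ev_smul; ring.
  + apply (IH (fun s => chi s * ev e s * ev e s)); [exact Hl'|].
    intros s t; rewrite Hchi, ev_smul; ring.
- intros s Hs; simpl; rewrite exp_plus, (exp_spin_expansion J _ (ev_value N s e Hs)).
  unfold E; ring.
Qed.

(* Ginibre's duplication: in [Z (x :: y :: w) * Z w - Z (x :: w) * Z (y :: w)]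
   substitute [s' := s t] in the second replica; for fixed [t] the sum over [s]
   is then a ferromagnetic one, with couplings [beta * (1 + ev e t)]. *)
Lemma griffiths_second N beta x y w : 0 <= beta ->
  partition_fun N beta (x :: w) * partition_fun N beta (y :: w) <=
  partition_fun N beta (x :: y :: w) * partition_fun N beta w.
Proof.
intros Hb; apply Rminus_le_0.
unfold partition_fun; rewrite !rsum_mult.
(* [x] acts on the first replica in both products and keeps coupling [beta]; only the events of [w]
   act on both replicas. *)
set (cpl := fun t => (beta, x) :: map (fun e => (beta * (1 + ev e t), e)) w).
set (E := fun t s => exp (rsum (fun p => fst p * ev (snd p) s) (cpl t))).
assert (HE : forall s t, E t s =
  exp (beta * ev x s + beta * energy w s + beta * energy w (smul s t))).
{ intros s t; unfold E, cpl; f_equal; simpl; rewrite rsum_map; simpl.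
  unfold energy; rewrite Rplus_assoc, <- !rsum_scal, <- rsum_plus; f_equal.
  apply rsum_ext; intros e; rewrite ev_smul; ring. }
set (d := fun s t => exp (beta * energy (x :: y :: w) s) * exp (beta * energy w t)
  - exp (beta * energy (x :: w) s) * exp (beta * energy (y :: w) t)).
assert (Hd : rsum (fun s => rsum (fun t => exp (beta * energy (x :: y :: w) s) *
                                exp (beta * energy w t)) (spins N)) (spins N)
  - rsum (fun s => rsum (fun t => exp (beta * energy (x :: w) s) *
                                exp (beta * energy (y :: w) t)) (spins N)) (spins N)
  = rsum (fun s => rsum (d s) (spins N)) (spins N)).
{ rewrite <- rsum_minus; apply rsum_ext; intros s.
  now rewrite <- rsum_minus. }
rewrite Hd.
rewrite (rsum_ext_in _ (fun s => rsum (fun t => d s (smul s t)) (spins N))).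
2: { intros s Hs; rewrite <- (rsum_spins_smul N s (d s) Hs).
     apply rsum_ext; intros t; now rewrite smul_comm. }
rewrite rsum_swap; apply rsum_ge0; intros t Ht.
(* What remains of [y] is exp(beta y(s)) - exp(beta y(s) y(t)), expanded by [exp_spin_expansion];
   its coefficients are nonnegative because |y(t)| <= 1. *)
rewrite (rsum_ext_in _ (fun s =>
  sinh beta * (1 - ev y t) * (ev y s * E t s) +
  (cosh beta - 1) * (1 - ev y t * ev y t) * (ev y s * ev y s * E t s))).
- rewrite rsum_plus, !rsum_scal.
  pose proof (cosh_ge1 beta); pose proof (sinh_ge0 beta Hb).
  assert (Hc : forall p, In p (cpl t) -> 0 <= fst p).
  { intros p [<-|Hp]; [exact Hb|].
    apply in_map_iff in Hp; destruct Hp as (e & <- & _); simpl.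
    apply Rmult_le_pos; [exact Hb|destruct (ev_value N t e Ht) as [->|[->| ->]]; lra]. }
  assert (0 <= 1 - ev y t /\ 0 <= 1 - ev y t * ev y t) as [? ?]
    by (destruct (ev_value N t y Ht) as [->|[->| ->]]; lra).
  apply Rplus_le_le_0_compat; apply Rmult_le_pos; try (apply Rmult_le_pos; lra).
  + apply (griffiths_first N (cpl t) (ev y) Hc), ev_smul.
  + apply (griffiths_first N (cpl t) (fun s => ev y s * ev y s) Hc).
    intros s u; rewrite ev_smul; ring.
- intros s Hs; rewrite HE; unfold d.
  transitivity (exp (beta * ev x s + beta * energy w s + beta * energy w (smul s t)) *
    (exp (beta * ev y s) - exp (beta * (ev y s * ev y t)))).
  + rewrite <- (ev_smul y s t), Rmult_minus_distr_l, <- !exp_plus; unfold energy; simpl.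
    f_equal; f_equal; ring.
  + rewrite (exp_spin_expansion beta _ (ev_value N s y Hs)).
    rewrite (exp_spin_expansion beta (ev y s * ev y t)); [ring|].
    destruct (ev_value N s y Hs) as [->|[->| ->]],
      (ev_value N t y Ht) as [->|[->| ->]]; lra.
Qed.

Lemma pressure_supermodular N beta x y w : 0 <= beta ->
  pressure N beta (x :: w) + pressure N beta (y :: w) <=
  pressure N beta (x :: y :: w) + pressure N beta w.
Proof.
intros Hb; unfold pressure.
rewrite <- !ln_mult by now apply partition_fun_pos.
apply ln_le; [|now apply griffiths_second].
apply Rmult_lt_0_compat; now apply partition_fun_pos.
Qed.

(** * From supermodularity to convexity of Poisson means *)

Definition wmean {A : Type} (L : list A) (f : list A -> R) (k : nat) : R :=
  wsum L k f / INR (length L) ^ k.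

Definition diff (b : nat -> R) (k : nat) : R := b (S k) - b k.

(** The second difference at [k] is the average of f(xyw) - f(xw) - f(yw) + f(w) over two letters x,
    y and a word w of length [k]. *)
Lemma wmean_convex {A : Type} (L : list A) (f : list A -> R) k :
  (0 < length L)%nat ->
  (forall x y w, f (x :: w) + f (y :: w) <= f (x :: y :: w) + f w) ->
  0 <= diff (diff (wmean L f)) k.
Proof.
intros HL Hf; apply lt_0_INR in HL.
assert (Hx : 0 <= wsum L (S (S k)) f - 2 * (INR (length L) * wsum L (S k) f)
                  + INR (length L) * INR (length L) * wsum L k f).
(* The doubled middle term is symmetrised: one copy forgets y, the other x, each padded by an idle
   sum over [L]. *)
{ replace (2 * _) with
    (rsum (fun x => rsum (fun y => wsum L k (fun w => f (x :: w))) L) L +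
     rsum (fun x => rsum (fun y => wsum L k (fun w => f (y :: w))) L) L).
  - rewrite Rmult_assoc, <- rsum_const.
    simpl wsum; rewrite <- rsum_plus, <- rsum_minus, <- rsum_plus.
    apply rsum_ge0; intros x _.
    rewrite <- rsum_const, <- rsum_plus, <- rsum_minus, <- rsum_plus.
    apply rsum_ge0; intros y _.
    rewrite <- wsum_plus, <- wsum_minus, <- wsum_plus.
    apply wsum_ge0; intros w; specialize (Hf x y w); lra.
  - rewrite rsum_const; simpl wsum.
    rewrite (rsum_ext _ _ L (fun x => rsum_const _ L)), rsum_scal; ring. }
unfold diff, wmean; simpl pow.
set (n := INR (length L)) in *.
assert (Hk : 0 < n ^ k) by now apply pow_lt.
replace (_ - _) with ((wsum L (S (S k)) f - 2 * (n * wsum L (S k) f) + n * n * wsum L k f)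
  * / (n * (n * n ^ k))) by (field; split; lra).
apply Rmult_le_pos; [exact Hx|].
apply Rlt_le, Rinv_0_lt_compat; auto using Rmult_lt_0_compat.
Qed.

(** The expectation of [b] at a Poisson variable of mean [lam], written as a power series so that it
    can be differentiated term by term at every real [lam]. *)
Definition poisson_mean (b : nat -> R) (lam : R) : R :=
  exp (- lam) * PSeries (fun k => b k / INR (fact k)) lam.

Definition exp_bounded (b : nat -> R) :=
  exists C D, 0 <= C /\ 0 <= D /\ forall k, Rabs (b k) <= C * D ^ k.

Lemma exp_bounded_diff b : exp_bounded b -> exp_bounded (diff b).
Proof.
intros (C & D & HC & HD & Hb); exists (C * D + C), D.
split; [nra|]; split; [exact HD|]; intros k; unfold diff, Rminus.
eapply Rle_trans; [apply Rabs_triang|]; rewrite Rabs_Ropp.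
pose proof (Hb k); pose proof (Hb (S k)) as H1; simpl in H1; lra.
Qed.

Lemma exp_bounded_ex_series b x : exp_bounded b ->
  ex_series (fun k => Rabs (b k / INR (fact k) * x ^ k)).
Proof.
intros (C & D & HC & HD & Hb).
apply ex_series_dominated with (fun k => C * ((D * Rabs x) ^ k / INR (fact k))).
- intros k; rewrite Rabs_Rabsolu; unfold Rdiv.
  rewrite !Rabs_mult, <- RPow_abs, Rpow_mult_distr.
  pose proof (INR_fact_lt_0 k) as Hk; apply Rinv_0_lt_compat in Hk.
  rewrite (Rabs_right (/ _)) by lra.
  replace (C * _) with (C * D ^ k * / INR (fact k) * Rabs x ^ k) by ring.
  apply Rmult_le_compat_r; [apply pow_le, Rabs_pos|].
  apply Rmult_le_compat_r; [lra|apply Hb].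
- apply ex_series_Rmult_l, ex_series_exp.
Qed.

Lemma exp_bounded_radius b x : exp_bounded b ->
  Rbar_lt (Rabs x) (CV_radius (fun k => b k / INR (fact k))).
Proof.
(* The radius is a supremum, so strictness needs a point of convergence beyond |x|. *)
intros Hb; eapply Rbar_lt_le_trans with (Rabs x + 1); [simpl; lra|].
apply (proj1 (Lub_Rbar_correct (CV_disk (fun k => b k / INR (fact k))))).
now apply exp_bounded_ex_series.
Qed.

(** Differentiating the series shifts [b] by one and differentiating exp(- lam) subtracts [b]:
    together, a forward difference. *)
Lemma is_derive_poisson_mean b (lam : R) : exp_bounded b ->
  is_derive (poisson_mean b) lam (poisson_mean (diff b) lam).
Proof.
intros Hb; set (a := fun k => b k / INR (fact k)).
assert (Hr := exp_bounded_radius b lam Hb); fold a in Hr.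
replace (poisson_mean (diff b) lam) with
  (- exp (- lam) * PSeries a lam + exp (- lam) * PSeries (PS_derive a) lam).
- apply (@is_derive_mult R_AbsRing (fun l => exp (- l)) (PSeries a)).
  + auto_derive; [exact I|ring].
  + now apply is_derive_PSeries.
  + intros; apply Rmult_comm.
- unfold poisson_mean.
  rewrite (PSeries_ext (fun k => diff b k / INR (fact k)) (PS_minus (PS_derive a) a)).
  + rewrite PSeries_minus; [fold a; ring| |];
      apply CV_disk_correct, CV_disk_inside; rewrite ?CV_radius_derive; exact Hr.
  + intros k; unfold PS_minus, PS_plus, PS_opp, PS_derive, a, diff, plus, opp;
      rewrite fact_simpl, mult_INR; simpl.
    pose proof (INR_fact_neq_0 k).
    field; split; [assumption|].
    change (INR (S k) <> 0); apply not_0_INR; discriminate.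
Qed.

Lemma poisson_mean_ge0 b lam : 0 <= lam -> exp_bounded b ->
  (forall k, 0 <= b k) -> 0 <= poisson_mean b lam.
Proof.
intros Hlam Hg Hb; apply Rmult_le_pos; [apply Rlt_le, exp_pos|].
unfold PSeries; rewrite <- (Rmult_0_l (Series (fun _ => 0))), <- Series_scal_l.
apply Series_le.
- intros k; rewrite Rmult_0_l; split; [lra|].
  apply Rmult_le_pos; [|now apply pow_le].
  apply Rdiv_le_0_compat; [apply Hb|apply INR_fact_lt_0].
- now apply ex_series_Rabs, exp_bounded_ex_series.
Qed.

(** The mean value theorem turns the two slopes into values of [f1] at ordered points. Positivity of
    [f2] is asked only on the half line, where Poisson weights are nonnegative. *)
Lemma convex_slopes (f f1 f2 : R -> R) :
  (forall x, is_derive f x (f1 x)) -> (forall x, is_derive f1 x (f2 x)) ->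
  (forall x, 0 <= x -> 0 <= f2 x) ->
  forall x y z, 0 <= x -> x < y -> y < z ->
  (f y - f x) / (y - x) <= (f z - f y) / (z - y).
Proof.
intros D1 D2 Hpos x y z Hx Hxy Hyz.
destruct (MVT_cor2 f f1 x y Hxy) as (c & Ec & Hc);
  [intros; apply is_derive_Reals, D1|].
destruct (MVT_cor2 f f1 y z Hyz) as (c' & Ec' & Hc');
  [intros; apply is_derive_Reals, D1|].
destruct (MVT_cor2 f1 f2 c c' ltac:(lra)) as (c'' & Ec'' & Hc'');
  [intros; apply is_derive_Reals, D2|].
rewrite Ec, Ec'; specialize (Hpos c'' ltac:(lra)).
replace (f1 c * (y - x) / (y - x)) with (f1 c) by (field; lra).
replace (f1 c' * (z - y) / (z - y)) with (f1 c') by (field; lra).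
nra.
Qed.

Lemma A_N_poisson_mean N a beta : (0 < N)%nat -> 0 <= a -> 0 < beta ->
  INR N * A_N N a beta =
  poisson_mean (wmean (bonds N) (pressure N beta)) (a * INR N).
Proof.
intros HN Ha Hb; assert (Hn : 0 < INR N) by now apply lt_0_INR.
rewrite total_pressure_series by assumption; unfold poisson_mean, PSeries; f_equal.
apply Series_ext; intros k; unfold pterm, wmean; rewrite length_bonds.
unfold Rdiv; rewrite !Rpow_mult_distr, pow_inv.
field; split; [apply INR_fact_neq_0|now apply pow_nonzero, Rgt_not_eq].
Qed.

Lemma A_N_slopes N beta x y z : (0 < N)%nat -> 0 < beta ->
  0 <= x -> x < y -> y < z ->
  (A_N N y beta - A_N N x beta) / (y - x) <= (A_N N z beta - A_N N y beta) / (z - y).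
Proof.
intros HN Hb Hx Hxy Hyz; assert (Hn : 0 < INR N) by now apply lt_0_INR.
set (b := wmean (bonds N) (pressure N beta)).
assert (Hlen : 0 < INR (length (bonds N))) by (rewrite length_bonds; nra).
assert (Hg : exp_bounded b).
{ destruct (pressure_growth N beta Hb) as (C & D & HC & HD & Hf).
  exists C, D; split; [exact HC|]; split; [exact HD|]; intros k.
  unfold b, wmean.
  assert (Hk : 0 < INR (length (bonds N)) ^ k) by now apply pow_lt.
  unfold Rdiv; rewrite Rabs_mult, (Rabs_right (/ _)) by (apply Rle_ge, Rlt_le, Rinv_0_lt_compat, Hk).
  apply (Rmult_le_reg_r _ _ _ Hk); rewrite Rmult_assoc, Rinv_l, Rmult_1_r by lra.
  rewrite (Rmult_comm (C * _)); apply wsum_abs_le; intros w <-; apply Hf. }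
assert (S := convex_slopes (poisson_mean b) _ _
  (fun l => is_derive_poisson_mean b l Hg)
  (fun l => is_derive_poisson_mean _ l (exp_bounded_diff b Hg))).
specialize (S (fun l Hl => poisson_mean_ge0 _ l Hl
  (exp_bounded_diff _ (exp_bounded_diff b Hg))
  (fun k => wmean_convex _ _ k (INR_lt 0 _ Hlen)
    (fun e e' w => pressure_supermodular N beta e e' w (Rlt_le _ _ Hb))))).
specialize (S (x * INR N) (y * INR N) (z * INR N)).
unfold b in S; rewrite <- !A_N_poisson_mean in S by (auto; lra).
replace ((A_N N y beta - A_N N x beta) / (y - x)) with
  ((INR N * A_N N y beta - INR N * A_N N x beta) / (y * INR N - x * INR N))
  by (field; repeat split; try lra; nra).
replace ((A_N N z beta - A_N N y beta) / (z - y)) with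
  ((INR N * A_N N z beta - INR N * A_N N y beta) / (z * INR N - y * INR N))
  by (field; repeat split; try lra; nra).
apply S; nra.
Qed.

(** * Passing to the limit: secants of convex functions and Cesaro means *)

Lemma slope_left_endpoint (f : R -> R) x y z : x < y -> y < z ->
  (f y - f x) / (y - x) <= (f z - f y) / (z - y) ->
  (f z - f x) / (z - x) <= (f z - f y) / (z - y).
Proof.
intros Hxy Hyz H.
apply Rle_div_l; [lra|].
replace (f z - f x) with ((f z - f y) / (z - y) * (z - y) + (f y - f x) / (y - x) * (y - x))
  by (field; lra).
replace (z - x) with ((z - y) + (y - x)) by ring.
rewrite Rmult_plus_distr_l; apply Rplus_le_compat_l, Rmult_le_compat_r; lra.
Qed.

Lemma is_lim_seq_inv_INR k : is_lim_seq (fun n => / INR (n + S k)) 0.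
Proof.
replace (Finite 0) with (Rbar_inv p_infty) by reflexivity.
apply is_lim_seq_inv; [|discriminate].
apply (is_lim_seq_incr_n INR), is_lim_seq_INR.
Qed.

(** The moving secant is trapped between the secants over [alpha - h, alpha] and [alpha, alpha + h]
    for a fixed h. These involve three fixed points, so pointwise convergence suffices, and their
    limits are close to [dA] for small h. *)
Lemma convex_limit_slope (f : nat -> R -> R) (A : R -> R) (alpha dA delta : R) (x : nat -> R) :
  0 < alpha -> 0 < delta ->
  (forall n a b c, 0 <= a -> a < b -> b < c ->
     (f n b - f n a) / (b - a) <= (f n c - f n b) / (c - b)) ->
  (forall a, Rabs (a - alpha) < delta -> is_lim_seq (fun n => f n a) (A a)) ->
  derivable_pt_lim A alpha dA ->
  (forall n, 0 <= x n < alpha) -> is_lim_seq x alpha ->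
  is_lim_seq (fun n => (f n alpha - f n (x n)) / (alpha - x n)) dA.
Proof.
intros Ha Hd Hconv HA HdA Hx Lx.
apply is_lim_seq_Reals; intros eps Heps.
destruct (HdA (eps / 2) ltac:(lra)) as [[d Hd0] Hder]; simpl in Hder.
(* Halving makes all bounds strict: alpha ± h lies where the limit exists, alpha - h > 0, and h is
   within the range of the derivative estimate. *)
set (h := Rmin (Rmin delta alpha) d / 2).
assert (Hh : 0 < h /\ h < delta /\ h < alpha /\ h < d).
{ unfold h; pose proof (Rmin_l (Rmin delta alpha) d); pose proof (Rmin_r (Rmin delta alpha) d).
  pose proof (Rmin_l delta alpha); pose proof (Rmin_r delta alpha).
  assert (0 < Rmin (Rmin delta alpha) d) by (repeat apply Rmin_glb_lt; auto).
  repeat split; lra. }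
destruct Hh as (Hh0 & Hhd & Hha & Hhd').
assert (L : forall k, Rabs k = h ->
  is_lim_seq (fun n => (f n (alpha + k) - f n alpha) / k) ((A (alpha + k) - A alpha) / k)).
{ intros k Hk; unfold Rdiv.
  apply (is_lim_seq_mult' _ _ _ (/ k)); [|apply is_lim_seq_const].
  apply is_lim_seq_minus'; apply HA.
  - replace (alpha + k - alpha) with k by ring; lra.
  - rewrite Rminus_diag, Rabs_R0; lra. }
assert (B : forall k, Rabs k = h -> exists n0, forall n, (n >= n0)%nat ->
  Rabs ((f n (alpha + k) - f n alpha) / k - dA) < eps).
{ intros k Hk; specialize (L k Hk); apply is_lim_seq_Reals in L.
  destruct (L (eps / 2) ltac:(lra)) as [n0 H0]; exists n0; intros n Hn.
  specialize (H0 n Hn); unfold Rdist in H0.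
  assert (Hk0 : k <> 0) by (intros ->; rewrite Rabs_R0 in Hk; lra).
  specialize (Hder k Hk0 ltac:(lra)).
  apply Rabs_def2 in H0; apply Rabs_def2 in Hder; apply Rabs_def1; lra. }
destruct (B h) as [n1 H1]; [apply Rabs_right; lra|].
destruct (B (- h)) as [n2 H2]; [rewrite Rabs_Ropp; apply Rabs_right; lra|].
apply is_lim_seq_Reals in Lx; destruct (Lx h Hh0) as [n3 H3].
exists (max n1 (max n2 n3)); intros n Hn.
specialize (H1 n ltac:(lia)); specialize (H2 n ltac:(lia)); specialize (H3 n ltac:(lia)).
unfold Rdist in *; specialize (Hx n).
apply Rabs_def2 in H1; apply Rabs_def2 in H2; apply Rabs_def2 in H3.
(* [U] bounds the moving secant above and [V] below; [V] needs alpha - h < x n, which [n3]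
   provides. *)
assert (U := Hconv n (x n) alpha (alpha + h) ltac:(lra) ltac:(lra) ltac:(lra)).
assert (V := Hconv n (alpha - h) (x n) alpha ltac:(lra) ltac:(lra) ltac:(lra)).
apply slope_left_endpoint in V; try lra.
replace (alpha + h - alpha) with h in U by ring.
replace ((f n alpha - f n (alpha - h)) / (alpha - (alpha - h))) with
  ((f n (alpha + - h) - f n alpha) / - h) in V
  by (replace (alpha + - h) with (alpha - h) by ring; field; lra).
apply Rabs_def1; lra.
Qed.

Lemma Cesaro_increments (F : nat -> R) (l : R) :
  is_lim_seq (fun n => F (S n) - F n) l -> is_lim_seq (fun n => F n / INR (S n)) l.
Proof.
intros H.
(* Starting with F 0 makes the partial sums telescope to F n exactly, a sum of n + 1 terms. *)
set (D := fun n => match n with O => F O | S n' => F (S n') - F n' end).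
assert (HD : is_lim_seq D l) by (apply is_lim_seq_incr_1; exact H).
apply is_lim_seq_Reals, Cesaro_1 in HD.
apply is_lim_seq_Reals, is_lim_seq_incr_1 in HD.
apply is_lim_seq_ext with (2 := HD); intros n; f_equal; simpl pred.
induction n as [|n IH]; [reflexivity|].
rewrite tech5, IH; simpl; ring.
Qed.

Theorem theorem1 (alpha beta : R) (Halpha : 1 / 2 < alpha) (Hbeta : 0 < beta)
  (A : R -> R) (dA Psi : R)
  (HA : exists delta, 0 < delta /\
          forall a, Rabs (a - alpha) < delta ->
            Un_cv (fun n => A_N (S n) a beta) (A a))
  (HdA : derivable_pt_lim A alpha dA)
  (HPsi : Un_cv (fun n => Psi_N (S n) (alpha_tilde (S n) alpha) beta 1) Psi) :
  A alpha = ln 2 - alpha * dA + Psi.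
Proof.
destruct HA as (delta & Hdelta & HA).
assert (Hn : forall n, 0 < INR (n + 2)) by (intros; apply lt_0_INR; lia).
assert (Einv : forall n, 0 < / INR (n + 2) < 1).
{ intros n; split; [apply Rinv_0_lt_compat, Hn|].
  rewrite <- Rinv_1; apply Rinv_lt_contravar.
  - rewrite Rmult_1_l; apply Hn.
  - rewrite <- INR_1; apply lt_INR; lia. }
assert (Linv : is_lim_seq (fun n => / INR (n + 2)) 0) by exact (is_lim_seq_inv_INR 1).
set (x := fun n => alpha_tilde (S n) alpha).
(* The smaller system has S n spins, hence the denominator n + 2. *)
assert (Ex : forall n, alpha - x n = alpha * / INR (n + 2)).
{ intros n; unfold x, alpha_tilde; specialize (Hn n).
  replace (S n + 1)%nat with (n + 2)%nat by lia.
  replace (INR (S n)) with (INR (n + 2) - 1)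
    by (rewrite plus_INR, (S_INR n); simpl; ring).
  field; lra. }
assert (Hx : forall n, 0 <= x n < alpha).
{ intros n; specialize (Ex n); specialize (Einv n); split; nra. }
assert (Lx : is_lim_seq x alpha).
{ apply is_lim_seq_ext with (fun n => alpha - alpha * / INR (n + 2)).
  - intros n; rewrite <- Ex; ring.
  - replace (Finite alpha) with (Finite (alpha - alpha * 0)) by (f_equal; ring).
    apply is_lim_seq_minus'; [apply is_lim_seq_const|].
    apply is_lim_seq_mult'; [apply is_lim_seq_const|exact Linv]. }
assert (Lslope := convex_limit_slope (fun n a => A_N (S n) a beta) A alpha dA delta x
  ltac:(lra) Hdelta
  (fun n a b c Ha Hab Hbc => A_N_slopes (S n) beta a b c (Nat.lt_0_succ n) Hbeta Ha Hab Hbc)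
  (fun a Ha => proj2 (is_lim_seq_Reals _ _) (HA a Ha)) HdA Hx Lx).
set (F := fun n => INR (S n) * A_N (S n) alpha beta).
assert (LF : is_lim_seq (fun n => F (S n) - F n) (ln 2 + beta * (alpha * 0) + Psi -
  (1 - 0) * alpha * dA)).
(* With N = S n, the factor (1 - 1/(n+2)) alpha is N (alpha - alpha~): it converts the difference of
   N A_N between alpha~ and alpha into a secant slope. *)
{ apply is_lim_seq_ext with (fun n =>
    ln 2 + beta * (alpha * / INR (n + 2)) + Psi_N (S n) (x n) beta 1 -
    (1 - / INR (n + 2)) * alpha *
    ((A_N (S n) alpha beta - A_N (S n) (x n) beta) / (alpha - x n))).
  - intros n; unfold F; rewrite (cavity_recursion (S n)) by (lia || lra).
    fold (x n); rewrite Ex; specialize (Hn n).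
    replace (S (S n)) with (n + 2)%nat by lia.
    replace (INR (S n)) with (INR (n + 2) - 1)
      by (rewrite plus_INR, (S_INR n); simpl; ring).
    field; split; lra.
  - apply is_lim_seq_minus'.
    + apply is_lim_seq_plus'; [|now apply is_lim_seq_Reals].
      apply is_lim_seq_plus'; [apply is_lim_seq_const|].
      apply is_lim_seq_mult'; [apply is_lim_seq_const|].
      apply is_lim_seq_mult'; [apply is_lim_seq_const|exact Linv].
    + apply is_lim_seq_mult'; [|exact Lslope].
      apply is_lim_seq_mult'; [|apply is_lim_seq_const].
      apply is_lim_seq_minus'; [apply is_lim_seq_const|exact Linv]. }
apply Cesaro_increments, is_lim_seq_Reals in LF.
assert (LA : Un_cv (fun n => F n / INR (S n)) (A alpha)).
{ apply is_lim_seq_Reals.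
  apply is_lim_seq_ext with (fun n => A_N (S n) alpha beta).
  - intros n; unfold F; field; apply not_0_INR; discriminate.
  - apply is_lim_seq_Reals, HA; rewrite Rminus_diag, Rabs_R0; exact Hdelta. }
rewrite (UL_sequence _ _ _ LA LF); ring.
Qed.
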